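(* Let $\mathbb{K}$ be a field, let $S=\mathbb{K}[x_1,\ldots,x_n]$, and let $I$ be a squarefree monomial ideal in $S$ different from $S$. Then there is an integer $k_0$ such that for all $k\ge k_0$ the ring $S/I^{(k)}$ is Golod, where $I^{(k)}$ denotes the $k$-th symbolic power of $I$.
   Context: Symbolic power: for a squarefree monomial ideal $I\neq S$ with (irredundant) primary decomposition $I=\mathfrak{p}_1\cap\cdots\cap\mathfrak{p}_r$, where each $\mathfrak{p}_i$ is a prime ideal generated by a subset of the variables, the $k$-th symbolic power is $I^{(k)}=\mathfrak{p}_1^k\cap\cdots\cap\mathfrak{p}_r^k$. Golod property: For a graded ideal $L\subseteq S=\mathbb{K}[x_1,\ldots,x_n]$, the ring $S/L$ is called Golod if all Massey operations on the Koszul complex $K$ of $S/L$ with respect to $\mathbf{x}=x_1,\ldots,x_n$ vanish. Precisely: $K$ is a differential graded $\mathbb{K}$-algebra with differential $d$ and homology $\operatorname{H}_*(\mathbf{x},S/L)$; $S/L$ is Golod if there are a homogeneous $\mathbb{K}$-basis $B$ of $\bigoplus_{i\ge 1}\operatorname{H}_i(\mathbf{x},S/L)$ and a function $\mu$ assigning to each finite sequence $(h_1,\ldots,h_p)\in B^p$, $p\ge 1$, a homogeneous element of $K$ such that $\mu(h)$ is a cycle representing $h$ for all $h\in B$, and $d\mu(h_1,\ldots,h_p)=\sum_{j=1}^{p-1}\overline{\mu(h_1,\ldots,h_j)}\,\mu(h_{j+1},\ldots,h_p)$ for all $p\ge 2$, where $\overline{a}=(-1)^{|a|+1}a$ and $|a|$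 is the homological degree of $a$. For $L\subseteq(x_1,\ldots,x_n)^2$ this is equivalent to the equality of power series $\sum_{i\ge 0}\dim_{\mathbb{K}}\operatorname{Tor}_i^{S/L}(\mathbb{K},\mathbb{K})t^i=\dfrac{(1+t)^n}{1-t\sum_{i\ge 1}\dim_{\mathbb{K}}\operatorname{Tor}_i^S(S/L,\mathbb{K})t^i}$. *)

(* Defs.v *)
From HB Require Import structures.
From mathcomp Require Import all_boot all_order all_algebra.
From mathcomp Require Import generic_quotient ring_quotient.
From mathcomp Require Import boolp.
From mathcomp Require Import mpoly.

Set Implicit Arguments.
Unset Strict Implicit.
Unset Printing Implicit Defensive.

Import GRing.Theory.
Local Open Scope ring_scope.
Local Open Scope quotient_scope.

(* Unlike idealr in ring_quotient, the unit ideal is allowed here, so that the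
   ideals of a ring are stable under intersections and powers. *)
Record ideal (R : comNzRingType) := Ideal {
  in_ideal :> R -> Prop;
  ideal0 : in_ideal 0;
  idealD : forall f g, in_ideal f -> in_ideal g -> in_ideal (f + g);
  idealM : forall a f, in_ideal f -> in_ideal (a * f)
}.

Section IdealOperations.
Variable R : comNzRingType.
Implicit Types (L : ideal R) (G : R -> Prop).

Definition eq_ideal L1 L2 : Prop := forall f, L1 f <-> L2 f.

Definition gen_mem G (f : R) : Prop :=
  exists s : seq (R * R),
    (forall p, p \in s -> G p.2) /\ f = \sum_(p <- s) p.1 * p.2.

Lemma gen_mem0 G : gen_mem G 0.
Proof. by exists [::]; split=> //; rewrite big_nil. Qed.

Lemma gen_memD G f g : gen_mem G f -> gen_mem G g -> gen_mem G (f + g).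
Proof.
move=> [s [sG ->]] [t [tG ->]]; exists (s ++ t); split; last by rewrite big_cat.
by move=> p; rewrite mem_cat => /orP[/sG|/tG].
Qed.

Lemma gen_memM G a f : gen_mem G f -> gen_mem G (a * f).
Proof.
move=> [s [sG ->]]; exists [seq (a * p.1, p.2) | p <- s]; split.
  by move=> _ /mapP[p /sG Gp ->].
by rewrite big_map mulr_sumr; apply: eq_bigr => p _; rewrite mulrA.
Qed.

Definition ideal_gen G : ideal R :=
  Ideal (gen_mem0 G) (@gen_memD G) (@gen_memM G).

Definition ideal_exp L (k : nat) : ideal R :=
  ideal_gen (fun f => exists t : k.-tuple R,
    (forall g, g \in t -> L g) /\ f = \prod_(g <- t) g).

Section Bigcap.
Variables (J : Type) (D : J -> Prop) (F : J -> ideal R).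

Definition bigcap_mem (f : R) : Prop := forall j, D j -> F j f.

Lemma bigcap_mem0 : bigcap_mem 0.
Proof. by move=> j _; apply: ideal0. Qed.

Lemma bigcap_memD f g : bigcap_mem f -> bigcap_mem g -> bigcap_mem (f + g).
Proof. by move=> Ff Fg j Dj; apply: idealD; [apply: Ff | apply: Fg]. Qed.

Lemma bigcap_memM a f : bigcap_mem f -> bigcap_mem (a * f).
Proof. by move=> Ff j Dj; apply: idealM; apply: Ff. Qed.

Definition ideal_bigcap : ideal R := Ideal bigcap_mem0 bigcap_memD bigcap_memM.
End Bigcap.

End IdealOperations.

Section SquarefreeMonomialIdeals.
Variables (K : fieldType) (n : nat).
Local Notation S := {mpoly K[n]}.
Implicit Types (I : ideal S) (F : {set 'I_n}) (P : {set {set 'I_n}}).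

Definition squarefree_monomial_ideal I : Prop :=
  exists G : 'X_{1..n} -> Prop,
    (forall m, G m -> forall i, (m i <= 1)%N) /\
    eq_ideal I (ideal_gen (fun f => exists2 m, G m & f = 'X_[m])).

Definition var_ideal F : ideal S :=
  ideal_gen (fun f => exists2 i, i \in F & f = 'X_i).

Definition cap_var_ideals P : ideal S :=
  ideal_bigcap (fun F => F \in P) var_ideal.

Definition irredundant_primary_decomposition I P : Prop :=
  eq_ideal I (cap_var_ideals P) /\
  forall F, F \in P -> ~ eq_ideal I (cap_var_ideals (P :\ F)).

(* A squarefree monomial ideal I <> S has exactly one irredundant decomposition
   of this shape, so the F ranged over are its components. *)
Definition symbolic_power I (k : nat) : ideal S :=
  ideal_bigcap
    (fun F => exists2 P, irredundant_primary_decomposition I P & F \in P)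
    (fun F => ideal_exp (var_ideal F) k).

End SquarefreeMonomialIdeals.

Section QuotientModule.
Variables (K : comNzRingType) (V : lmodType K) (U : submodClosed V).

Definition submod_mem (v : V) : bool := v \in U.

Lemma submod_mem_closed : zmod_closed submod_mem.
Proof.
split=> [|v w vU wU]; first exact: rpred0.
by rewrite -topredE /= /submod_mem -scaleN1r rpredD // rpredZ.
Qed.

HB.instance Definition _ :=
  GRing.isZmodClosed.Build V submod_mem submod_mem_closed.

Definition submod_zmod : zmodClosed V := GRing.ZmodClosed.clone V submod_mem _.

Definition quot_lmod : Type := Quotient.quot submod_zmod.
HB.instance Definition _ := GRing.Zmodule.on quot_lmod.
HB.instance Definition _ := EqQuotient.on quot_lmod.

Definition quot_scale (c : K) (x : quot_lmod) : quot_lmod :=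
  \pi_quot_lmod (c *: repr x).

Lemma quot_eq (v w : V) :
  (\pi_quot_lmod v == \pi_quot_lmod w) = (v - w \in U).
Proof. by rewrite [RHS](Quotient.idealrBE submod_zmod). Qed.

Lemma quot_piD (v w : V) :
  \pi_quot_lmod (v + w) = \pi_quot_lmod v + \pi_quot_lmod w.
Proof. exact: (raddfD \pi_(Quotient.quot submod_zmod)). Qed.

Lemma quot_piZ c (v : V) : quot_scale c (\pi v) = \pi_quot_lmod (c *: v).
Proof.
apply/eqP; rewrite quot_eq -scalerBr rpredZ // -quot_eq; apply/eqP.
exact: reprK.
Qed.

Lemma quot_scaleA a b (x : quot_lmod) :
  quot_scale a (quot_scale b x) = quot_scale (a * b) x.
Proof. by rewrite quot_piZ scalerA. Qed.

Lemma quot_scale1 : left_id 1 quot_scale.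
Proof. by move=> x; rewrite /quot_scale scale1r reprK. Qed.

Lemma quot_scaleDr : right_distributive quot_scale +%R.
Proof.
move=> c x y; rewrite -[x]reprK -[y]reprK -quot_piD !quot_piZ.
by rewrite scalerDr quot_piD.
Qed.

Lemma quot_scaleDl (x : quot_lmod) :
  {morph quot_scale^~ x : a b / a + b}.
Proof. by move=> a b; rewrite /quot_scale scalerDl quot_piD. Qed.

HB.instance Definition _ := GRing.Zmodule_isLmodule.Build K quot_lmod
  quot_scaleA quot_scale1 quot_scaleDr quot_scaleDl.

End QuotientModule.

Section QuotientRing.
Variables (K : fieldType) (A : comAlgType K) (L : ideal A).

Definition ideal_pred (f : A) : bool := `[< L f >].

Lemma ideal_pred_submod : GRing.subsemimod_closed ideal_pred.
Proof.
split; first split.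
- exact/asboolP/ideal0.
- by move=> f g /asboolP Lf /asboolP Lg; apply/asboolP/idealD.
- move=> c f /asboolP Lf; apply/asboolP.
  by rewrite -mulr_algl; apply: idealM.
Qed.

HB.instance Definition _ :=
  GRing.isSubmodClosed.Build K A ideal_pred ideal_pred_submod.

Definition ideal_submod : submodClosed A :=
  GRing.SubmodClosed.clone K A ideal_pred _.

Definition quot_ring : Type := quot_lmod ideal_submod.
HB.instance Definition _ := GRing.Lmodule.on quot_ring.

Definition quot_pi (f : A) : quot_ring := \pi_(quot_lmod ideal_submod) f.

Definition quot_repr (x : quot_ring) : A := repr (x : quot_lmod ideal_submod).

Definition quot_one : quot_ring := quot_pi 1.

Definition quot_mul (x y : quot_ring) : quot_ring :=
  quot_pi (quot_repr x * quot_repr y).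

Lemma quot_reprK : cancel quot_repr quot_pi.
Proof. by move=> x; exact: reprK. Qed.

Lemma quot_piP f g : reflect (quot_pi f = quot_pi g) (ideal_pred (f - g)).
Proof. by rewrite -[ideal_pred _]quot_eq; exact: eqP. Qed.

Lemma quot_piM f g : quot_mul (quot_pi f) (quot_pi g) = quot_pi (f * g).
Proof.
have Lrepr h : L (quot_repr (quot_pi h) - h).
  by apply/asboolP/quot_piP; rewrite quot_reprK.
apply/quot_piP/asboolP; set f' := quot_repr _; set g' := quot_repr _.
have -> : f' * g' - f * g = f' * (g' - g) + g * (f' - f).
  by rewrite mulrBr mulrBr addrA [g * f']mulrC [g * f]mulrC subrK.
by apply: idealD; apply: idealM; apply: Lrepr.
Qed.

Lemma quot_mulA : associative quot_mul.
Proof.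
move=> x y z; rewrite -[x]quot_reprK -[y]quot_reprK -[z]quot_reprK.
by rewrite !quot_piM mulrA.
Qed.

Lemma quot_mulC : commutative quot_mul.
Proof. by move=> x y; rewrite /quot_mul mulrC. Qed.

Lemma quot_mul1 : left_id quot_one quot_mul.
Proof. by move=> x; rewrite -[x]quot_reprK quot_piM mul1r. Qed.

Lemma quot_mulDl : left_distributive quot_mul +%R.
Proof.
move=> x y z; rewrite -[x]quot_reprK -[y]quot_reprK -[z]quot_reprK.
by rewrite -[quot_pi _ + _]quot_piD !quot_piM mulrDl -[RHS]quot_piD.
Qed.

HB.instance Definition _ := GRing.Zmodule_isComPzRing.Build quot_ring
  quot_mulA quot_mulC quot_mul1 quot_mulDl.

Lemma quot_scalerAr (c : K) (x y : quot_ring) : c *: (x * y) = x * (c *: y).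
Proof.
rewrite -[x]quot_reprK -[y]quot_reprK.
rewrite [_ * quot_pi _]quot_piM [c *: quot_pi (_ * _)]quot_piZ.
by rewrite [c *: quot_pi _]quot_piZ [RHS]quot_piM scalerAr.
Qed.

End QuotientRing.

(* The element a of the Koszul complex of R with respect to x_0, ..., x_(n-1)
   stands for \sum_A a A e_A, where e_A is the exterior product of the e_i, i in
   A, taken in increasing order of i. *)
Section Koszul.
Variables (R : comPzRingType) (n : nat).
Local Notation koszul := {ffun {set 'I_n} -> R}.
Implicit Types (x : 'I_n -> R) (a b : koszul).

(* d e_A = \sum_(i in A) (-1) ^+ #{j in A | j < i} x_i e_(A \ i). *)
Definition koszul_d x a : koszul :=
  [ffun A : {set 'I_n} => \sum_(i | i \notin A)
     (-1) ^+ #|[set j in A | (j < i)%N]| * x i * a (i |: A)].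

Definition inversions (A B : {set 'I_n}) : nat :=
  #|[set p : 'I_n * 'I_n | [&& p.1 \in A, p.2 \in B & (p.2 < p.1)%N]]|.

(* e_A * e_B is (-1) ^+ inversions A B e_(A u B) if A and B are disjoint, and 0
   otherwise. *)
Definition koszul_mul a b : koszul :=
  [ffun C : {set 'I_n} => \sum_(A : {set 'I_n} | A \subset C)
     (-1) ^+ inversions A (C :\: A) * a A * b (C :\: A)].

(* On elements of homological degree i this is the product with (-1) ^+ i.+1. *)
Definition koszul_bar a : koszul :=
  [ffun A : {set 'I_n} => (-1) ^+ #|A|.+1 * a A].

Definition koszul_homogeneous (i : nat) a : Prop :=
  forall A : {set 'I_n}, a A != 0 -> #|A| = i.

End Koszul.

Section Golod.
Variables (K : fieldType) (n : nat) (L : ideal {mpoly K[n]}).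

Definition koszul : Type := {ffun {set 'I_n} -> quot_ring L}.
HB.instance Definition _ := GRing.Lmodule.on koszul.

Definition quot_var (i : 'I_n) : quot_ring L := quot_pi L 'X_i.

Definition koszul_diff (a : koszul) : koszul := koszul_d quot_var a.

Lemma koszul_diffD a b : koszul_diff (a + b) = koszul_diff a + koszul_diff b.
Proof.
apply/ffunP=> A; rewrite !ffunE -big_split; apply: eq_bigr => i _.
by rewrite ffunE mulrDr.
Qed.

Lemma koszul_diffZ (c : K) a : koszul_diff (c *: a) = c *: koszul_diff a.
Proof.
apply/ffunP=> A; rewrite !ffunE scaler_sumr; apply: eq_bigr => i _.
by rewrite ffunE quot_scalerAr.
Qed.

Lemma koszul_diff0 : koszul_diff 0 = 0.
Proof. by rewrite -[0 in LHS](scale0r (0 : koszul)) koszul_diffZ scale0r. Qed.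

Definition is_cycle (a : koszul) : bool := koszul_diff a == 0.

Lemma is_cycle_submod : GRing.subsemimod_closed is_cycle.
Proof.
split; first split.
- exact/eqP/koszul_diff0.
- by move=> a b /eqP da /eqP db; apply/eqP; rewrite koszul_diffD da db addr0.
- by move=> c a /eqP da; apply/eqP; rewrite koszul_diffZ da scaler0.
Qed.

HB.instance Definition _ :=
  GRing.isSubmodClosed.Build K koszul is_cycle is_cycle_submod.

Record koszul_cycle : Type :=
  KoszulCycle { cycle_val :> koszul; _ : is_cycle cycle_val }.
HB.instance Definition _ := [isSub for cycle_val].
HB.instance Definition _ := [Choice of koszul_cycle by <:].
HB.instance Definition _ := [SubChoice_isSubLmodule of koszul_cycle by <:].

Definition is_boundary (z : koszul_cycle) : bool :=
  `[< exists a : koszul, koszul_diff a = z >].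

Lemma is_boundary_submod : GRing.subsemimod_closed is_boundary.
Proof.
split; first split.
- by apply/asboolP; exists 0; rewrite koszul_diff0.
- move=> y z /asboolP[a da] /asboolP[b db]; apply/asboolP; exists (a + b).
  by rewrite koszul_diffD da db.
- move=> c z /asboolP[a da]; apply/asboolP; exists (c *: a).
  by rewrite koszul_diffZ da.
Qed.

HB.instance Definition _ :=
  GRing.isSubmodClosed.Build K koszul_cycle is_boundary is_boundary_submod.

Definition boundaries : submodClosed koszul_cycle :=
  GRing.SubmodClosed.clone K koszul_cycle is_boundary _.

Definition homology : lmodType K := quot_lmod boundaries.

Definition represents (a : koszul) (h : homology) : Prop :=
  exists2 z : koszul_cycle, cycle_val z = a & h = \pi_(quot_lmod boundaries) z.

Definition homology_deg (i : nat) (h : homology) : Prop :=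
  exists2 a, koszul_homogeneous i a & represents a h.

(* The elements of the direct sum of the H_i over i >= 1: a set0 is the
   component of a of homological degree 0. *)
Definition homology_pos (h : homology) : Prop :=
  exists2 a : koszul, a set0 = 0 & represents a h.

Definition lin_independent (V : lmodType K) (B : V -> Prop) : Prop :=
  forall (s : seq V) (c : V -> K), uniq s -> (forall v, v \in s -> B v) ->
    \sum_(v <- s) c v *: v = 0 -> forall v, v \in s -> c v = 0.

Definition in_span (V : lmodType K) (B : V -> Prop) (w : V) : Prop :=
  exists (s : seq V) (c : V -> K),
    (forall v, v \in s -> B v) /\ w = \sum_(v <- s) c v *: v.

Definition homogeneous_basis (B : homology -> Prop) : Prop :=
  [/\ forall h, B h -> exists2 i, (1 <= i)%N & homology_deg i h,
      lin_independent B &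
      forall h, homology_pos h -> in_span B h].

(* The sequence (h_1, ..., h_p) is [:: h_1; ...; h_p]; the value of mu at the
   empty sequence is irrelevant. *)
Definition trivial_massey (B : homology -> Prop) (mu : seq homology -> koszul)
    : Prop :=
  [/\ forall s, s != [::] -> (forall h, h \in s -> B h) ->
        exists i, koszul_homogeneous i (mu s),
      forall h, B h -> represents (mu [:: h]) h &
      forall s, (2 <= size s)%N -> (forall h, h \in s -> B h) ->
        koszul_diff (mu s) =
          \sum_(1 <= j < size s)
            koszul_mul (koszul_bar (mu (take j s))) (mu (drop j s))].

Definition golod : Prop :=
  exists (B : homology -> Prop) (mu : seq homology -> koszul),
    homogeneous_basis B /\ trivial_massey B mu.

End Golod.

(* Main.v *)
Require Import Defs.
From HB Require Import structures.
From mathcomp Require Import all_boot all_order all_algebra.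
From mathcomp Require Import generic_quotient.
From mathcomp Require Import boolp.
From mathcomp Require classical_sets.
From mathcomp Require Import mpoly.
From mathcomp Require Import ring.

(** The bound is k0 = 2.  Write L_k for the intersection of the powers P_F^k,
    where P_F is generated by the variables x_i, i in F, and F ranges over the
    components of I.  A polynomial lies in P_F^k when all its monomials have
    degree at least k in the variables of F ([var_ideal_expP]).  Hence dividing
    the monomials of an element of L_k by a variable leads into L_(k-1), and

      L_(k-1) * L_(k-1) is contained in L_(2k-2), hence in L_k once k >= 2.

    So it is enough to represent every homology class of positive degree of the
    Koszul complex of S/L_k by a cycle with coefficients in L_(k-1)/L_k: the
    products of such cycles are zero, and all Massey operations of length at
    least two can be chosen to be 0 ([golod_of_small_cycles]).

    These cycles come from the standard contraction h of the Koszul complex of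
    S.  It sends x^m e_G to (x^m / x_v) e_v e_G, where v is the least index
    occurring in m or in G, if v is not in G, and to 0 otherwise; on elements
    without component in degree 0 it satisfies d h + h d = 1 ([contractionP]).
    Lift a homogeneous cycle of positive degree over S/L_k to an element z over
    S.  Then z - d (h z) = h (d z), so h (d z) represents the same class; as the
    coefficients of d z lie in L_k and h divides monomials by one variable, the
    coefficients of h (d z) lie in L_(k-1).  Nothing is divided by an integer,
    which makes the argument independent of the characteristic.

    The classes of homogeneous cycles of positive degree span the positive part
    of the homology, and a basis is extracted from them by Zorn's lemma
    ([exists_basis_of_generators]). *)

Set Implicit Arguments.
Unset Strict Implicit.
Unset Printing Implicit Defensive.

Import GRing.Theory.
Local Open Scope ring_scope.
Local Open Scope quotient_scope.

(** * Bases inside generating sets *)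

Section Bases.
Variables (K : fieldType) (V : lmodType K).
Implicit Types (B G : V -> Prop) (v w : V).

(** In [in_span] the coefficient is a function of the vector.  Lists of pairs
    (coefficient, vector), in which a vector may occur several times with
    different coefficients, are easier to concatenate. *)
Lemma in_span_pairs B (s : seq (K * V)) :
  (forall p, p \in s -> B p.2) -> in_span B (\sum_(p <- s) p.1 *: p.2).
Proof.
move=> sB; exists (undup [seq p.2 | p <- s]).
exists (fun v => \sum_(p <- s | p.2 == v) p.1); split.
  by move=> v; rewrite mem_undup => /mapP[p /sB Bp ->].
under [RHS]eq_bigr do rewrite scaler_suml.
rewrite (exchange_big_dep xpredT) //= [LHS]big_seq [RHS]big_seq.
apply: eq_bigr => p ps.
rewrite big_mkcond (bigD1_seq p.2) ?undup_uniq ?mem_undup ?map_f //= eqxx.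
by rewrite big1 ?addr0 // => v; rewrite eq_sym => /negbTE->.
Qed.

Lemma in_span_sum B (s : seq (K * V)) :
  (forall p, p \in s -> in_span B p.2) -> in_span B (\sum_(p <- s) p.1 *: p.2).
Proof.
move=> sB.
suff [t tB ->] : exists2 t : seq (K * V), forall p, p \in t -> B p.2 &
    \sum_(p <- s) p.1 *: p.2 = \sum_(p <- t) p.1 *: p.2.
  exact: in_span_pairs.
elim: s sB => [|p s IHs] sB; first by exists [::].
rewrite big_cons; have [|t tB ->] := IHs.
  by move=> q qs; apply: sB; rewrite inE qs orbT.
have [u [c [uB pE]]] := sB p (mem_head _ _).
exists ([seq (p.1 * c v, v) | v <- u] ++ t).
  by move=> q; rewrite mem_cat => /orP[/mapP[v /uB Bv ->]|/tB].
rewrite big_cat big_map /=; congr (_ + _).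
by rewrite pE scaler_sumr; apply: eq_bigr => v _; rewrite scalerA.
Qed.

Lemma mem_in_span B v : B v -> in_span B v.
Proof.
move=> Bv; exists [:: v], (fun=> 1); rewrite big_seq1 scale1r; split=> // w.
by rewrite inE => /eqP->.
Qed.

Lemma lin_independentU1 B v : lin_independent B -> ~ in_span B v ->
  lin_independent (fun w => B w \/ w = v).
Proof.
move=> indB vB s c s_uniq sB sum0.
have sBv w : w \in rem v s -> B w.
  by rewrite mem_rem_uniq // inE => /andP[/eqP wv /sB[]].
have [vs|vs] := boolP (v \in s); last first.
  apply: (indB s) => // w ws.
  by case: (sB w ws) vs => // <-; rewrite ws.
have sumE : c v *: v + \sum_(w <- rem v s) c w *: w = 0.
  by rewrite -[RHS]sum0 [RHS](perm_big _ (perm_to_rem vs)) big_cons.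
(* Otherwise the relation could be solved for v. *)
have cv0 : c v = 0.
  apply/eqP/negP => /negP cv; case: vB.
  have -> : v = \sum_(p <- [seq (- (c v)^-1 * c w, w) | w <- rem v s])
                  p.1 *: p.2.
    rewrite big_map /=; under eq_bigr do rewrite -scalerA.
    rewrite -scaler_sumr (addrI _ (etrans sumE (esym (subrr (c v *: v))))).
    by rewrite scaleNr scalerN opprK scalerA mulVf // scale1r.
  by apply: in_span_pairs => _ /mapP[w /sBv Bw ->].
move: sumE; rewrite cv0 scale0r add0r => sumE w ws.
have [->//|wv] := eqVneq w v.
by apply: (indB (rem v s)); rewrite ?rem_uniq // mem_rem_uniq // inE wv.
Qed.

(** A maximal independent subset of G spans G, since any generator outside its
    span could be added to it ([lin_independentU1]).  Unions of chains of
    independent sets are independent because a relation involves finitely many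
    vectors, all of which lie in one member of the chain. *)
Lemma exists_basis_of_generators G :
  exists B, [/\ forall v, B v -> G v, lin_independent B &
    forall v, G v -> in_span B v].
Proof.
pose P B := (forall v, B v -> G v) /\ lin_independent B.
have [F FP Ftot|B [[BG indB] maxB]] := @classical_sets.Zorn_bigcup V P.
  split=> [v [B FB Bv]|s c s_uniq sF sum0]; first exact: (FP B FB).1.
  have [s_nil v|/negP s_nil] := boolP (s == [::]); first by rewrite (eqP s_nil).
  have [B FB sB] : exists2 B, F B & forall v, v \in s -> B v.
    elim: s {s_uniq sum0} sF s_nil => // v [_ sF _|w s IHs sF _].
      have [B FB Bv] := sF v (mem_head _ _).
      by exists B => // w; rewrite inE => /eqP->.
    have [|//|B FB sB] := IHs.
      by move=> u us; apply: sF; rewrite inE us orbT.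
    have [C FC Cv] := sF v (mem_head _ _).
    have [BC|CB] := Ftot _ _ FB FC.
      exists C => // u; rewrite inE => /orP[/eqP->//|us].
      exact/BC/sB.
    exists B => // u; rewrite inE => /orP[/eqP->|us]; first exact: CB.
    exact: sB.
  exact: (FP B FB).2.
exists B; split=> // v Gv; apply: contrapT => vB.
apply: (maxB (fun w => B w \/ w = v)).
  by split=> [w Bw|/(_ v (or_intror erefl)) /mem_in_span]; first left.
split; last exact: lin_independentU1.
by move=> w [/BG|->].
Qed.

End Bases.

(** * Powers of ideals generated by variables *)

Section OrderOfVanishing.
Variables (K : fieldType) (n : nat).
Local Notation S := {mpoly K[n]}.
Implicit Types (F : {set 'I_n}) (f g : S) (m : 'X_{1..n}).

Definition degree_in F m : nat := (\sum_(i in F) m i)%N.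

Definition order_ge F k f : Prop :=
  forall m, f@_m != 0 -> (k <= degree_in F m)%N.

Lemma degree_inD F m1 m2 :
  degree_in F (m1 + m2)%MM = (degree_in F m1 + degree_in F m2)%N.
Proof.
by rewrite /degree_in -big_split; apply: eq_bigr => i _; rewrite mnmDE.
Qed.

Lemma degree_inU F i : degree_in F U_(i)%MM = (i \in F).
Proof.
rewrite /degree_in; under eq_bigr do rewrite mnm1E.
have [iF|iF] := boolP (i \in F).
  rewrite (bigD1 i) //= eqxx big1 // => j /andP[_ ji].
  by rewrite eq_sym (negbTE ji).
by rewrite big1 // => j jF; case: eqP iF => // ->; rewrite jF.
Qed.

Lemma order_geM F j k f g :
  order_ge F j f -> order_ge F k g -> order_ge F (j + k) (f * g).
Proof.
move=> fj gk m; rewrite -mcoeff_msupp => /msuppM_le /allpairsP[[m1 m2] /=].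
rewrite !mcoeff_msupp => -[/fj m1j /gk m2k ->].
by rewrite degree_inD leq_add.
Qed.

Lemma order_geS F j k f : (j <= k)%N -> order_ge F k f -> order_ge F j f.
Proof. by move=> jk fk m /fk; apply: leq_trans. Qed.

Lemma order_ge0 F k : order_ge F k 0.
Proof. by move=> m; rewrite mcoeff0 eqxx. Qed.

Lemma order_geD F k f g :
  order_ge F k f -> order_ge F k g -> order_ge F k (f + g).
Proof.
move=> fk gk m; rewrite mcoeffD; have [-> |/fk//] := eqVneq (f@_m) 0.
by rewrite add0r => /gk.
Qed.

Lemma order_ge_sum F k (J : eqType) (s : seq J) (f : J -> S) :
  (forall j, j \in s -> order_ge F k (f j)) ->
  order_ge F k (\sum_(j <- s) f j).
Proof.
move=> fk; rewrite big_seq.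
by elim/big_rec: _ => [|j g /fk fj gk]; [apply: order_ge0|apply: order_geD].
Qed.

Lemma order_ge_mull F k f g : order_ge F k g -> order_ge F k (f * g).
Proof. by apply: (@order_geM F 0). Qed.

Lemma mnm_subK m i : (0 < m i)%N -> (m - U_(i) + U_(i))%MM = m.
Proof.
move=> mi; apply: submK; apply/mnm_lepP => j.
by rewrite mnm1E; case: eqP => // <-.
Qed.

Lemma mpolyX_var_factors F k m : (k <= degree_in F m)%N ->
  exists (t : k.-tuple S) (m' : 'X_{1..n}),
    (forall g, g \in t -> var_ideal K F g) /\
    'X_[m] = 'X_[m'] * \prod_(g <- t) g.
Proof.
elim: k m => [|k IHk] m km.
  by exists [tuple], m; rewrite big_nil mulr1.
have /existsP[i /andP[iF mi]] : [exists i, (i \in F) && (0 < m i)%N].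
  apply: contraTT km; rewrite negb_exists => /forallP m0.
  rewrite /degree_in big1 // => i iF.
  by move: (m0 i); rewrite iF lt0n => /negPn /eqP.
have mE := mnm_subK mi.
move: km; rewrite -{1}mE degree_inD degree_inU iF addn1 ltnS.
move=> /IHk[t [m' [tF tE]]]; exists [tuple of 'X_i :: t], m'; split.
  move=> g; rewrite inE => /orP[/eqP->|/tF//].
  exists [:: (1, 'X_i)]; rewrite big_seq1 mul1r; split=> // p.
  by rewrite inE => /eqP-> /=; exists i.
by rewrite big_cons -mE mpolyXD tE -mulrA; congr (_ * _); rewrite mulrC.
Qed.

Lemma ideal_sum (A : comNzRingType) (L : ideal A) (J : eqType) (s : seq J)
    (f : J -> A) :
  (forall j, j \in s -> L (f j)) -> L (\sum_(j <- s) f j).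
Proof.
move=> Lf; rewrite big_seq.
by elim/big_rec: _ => [|j g /Lf Lj Lg]; [apply: ideal0|apply: idealD].
Qed.

(** Membership in a power of P_F is a condition on the monomials: products of k
    elements of P_F have order at least k, and a monomial of degree at least k
    in F is divisible by a product of k variables of F ([mpolyX_var_factors]).
    *)
Lemma var_ideal_expP F k f : ideal_exp (var_ideal K F) k f <-> order_ge F k f.
Proof.
split=> [[s [sF ->]]|fk].
  apply: order_ge_sum => p /sF[t [tF ->]]; apply: order_ge_mull.
  have {tF} : forall g, g \in t -> order_ge F 1 g.
    move=> g /tF[u [uF ->]]; apply: order_ge_sum => q /uF[i iF ->].
    apply: order_ge_mull => m; rewrite mcoeffX.
    have [<- _|] := eqVneq U_(i)%MM m.
      by rewrite degree_inU iF.
    by rewrite eqxx.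
  suff tF : forall u : seq S, (forall g, g \in u -> order_ge F 1 g) ->
      order_ge F (size u) (\prod_(g <- u) g).
    by move=> /tF; rewrite size_tuple.
  elim=> [|g u IHu] uF; first by rewrite big_nil.
  rewrite big_cons; apply: (@order_geM F 1).
    by apply: uF; apply: mem_head.
  by apply: IHu => h hu; apply: uF; rewrite inE hu orbT.
rewrite [f]mpolyE; apply: ideal_sum => m; rewrite mcoeff_msupp => /fk km.
have [t [m' [tF ->]]] := mpolyX_var_factors km.
exists [:: (f@_m *: 'X_[m'], \prod_(g <- t) g)].
rewrite big_seq1 scalerAl; split=> // p; rewrite inE => /eqP-> /=.
by exists t.
Qed.

End OrderOfVanishing.

(** * The contraction of the Koszul complex of the polynomial ring *)

Section Contraction.
Variables (K : fieldType) (n : nat).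
Local Notation S := {mpoly K[n]}.
Local Notation koszulS := {ffun {set 'I_n} -> S}.
Local Notation d := (koszul_d (fun i : 'I_n => 'X_i : S)).
Implicit Types (A : {set 'I_n}) (f g : S) (m : 'X_{1..n}) (v i : 'I_n)
  (a : koszulS).

Definition avoids_below v m : bool :=
  [forall j : 'I_n, (j < v)%N ==> (m j == 0%N)].

Lemma avoids_belowP v m :
  reflect (forall j : 'I_n, (j < v)%N -> m j = 0%N) (avoids_below v m).
Proof.
apply: (iffP forallP) => [m0 j jv|m0 j]; first by apply/eqP/(implyP (m0 j)).
by apply/implyP => /m0->.
Qed.

(** Only the monomials whose least variable is x_v are kept, and divided by x_v:
    this is the coefficient map of the contraction. *)
Definition div_var v f : S :=
  \sum_(m <- msupp f | (0 < m v)%N && avoids_below v m) f@_m *: 'X_[m - U_(v)].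

Lemma avoids_belowD v i m : (v <= i)%N ->
  avoids_below v (m + U_(i))%MM = avoids_below v m.
Proof.
move=> vi; apply/avoids_belowP/avoids_belowP => m0 j jv; move: (m0 j jv);
  rewrite mnmDE mnm1E; first by move/eqP; rewrite addn_eq0 => /andP[/eqP].
by case: eqP => [ij|]; [move: jv; rewrite -ij ltnNge vi|rewrite addn0].
Qed.

(** The working description of [div_var]; multiplication by x_v does not change
    which variables below x_v occur. *)
Lemma mcoeff_div_var v f m :
  (div_var v f)@_m = if avoids_below v m then f@_(m + U_(v)) else 0.
Proof.
rewrite /div_var raddf_sum /=.
have mP : avoids_below v m =
    (0 < (m + U_(v))%MM v)%N && avoids_below v (m + U_(v))%MM.
  by rewrite avoids_belowD // mnmDE mnm1E eqxx addn1.
have [mv|mv] := boolP (m + U_(v) \in msupp f)%MM; last first.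
  rewrite big1_seq => [|m' /= /andP[/andP[m'v _] m'f]].
    by move: mv; rewrite mcoeff_msupp negbK => /eqP->; case: ifP.
  rewrite mcoeffZ mcoeffX; case: eqP => [mE|]; last by rewrite mulr0.
  by move: mv; rewrite -mE mnm_subK ?m'f.
rewrite big_mkcond (bigD1_seq _ mv) ?msupp_uniq //= -mP big1 ?addr0.
  by rewrite mcoeffZ mcoeffX addmK eqxx mulr1; case: ifP; rewrite ?mcoeff0.
move=> m' m'm; case: ifP => // /andP[m'v _].
rewrite mcoeffZ mcoeffX; case: eqP => [mE|]; last by rewrite mulr0.
by move: m'm; rewrite -mE mnm_subK ?eqxx.
Qed.

Lemma div_varD v : {morph div_var v : f g / f + g}.
Proof.
move=> f g; apply/mpolyP => m; rewrite mcoeffD !mcoeff_div_var.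
by case: ifP; rewrite ?mcoeffD ?addr0.
Qed.

Lemma div_var0 v : div_var v 0 = 0.
Proof. by apply/mpolyP => m; rewrite mcoeff_div_var !mcoeff0 if_same. Qed.

Lemma div_var_sign v s f : div_var v ((-1) ^+ s * f) = (-1) ^+ s * div_var v f.
Proof.
rewrite -signr_odd !mulr_sign; case: ifP => // _; apply/mpolyP => m.
by rewrite mcoeffN !mcoeff_div_var mcoeffN; case: ifP; rewrite ?oppr0.
Qed.

Lemma mcoeff_mulX i f m :
  ('X_i * f)@_m = if (0 < m i)%N then f@_(m - U_(i)) else 0.
Proof.
rewrite mulrC; case: ifP => [mi|mi].
  by rewrite -{1}(mnm_subK mi) addmC mcoeffMX.
apply/eqP/negPn/negP; rewrite -mcoeff_msupp => /msuppM_le /allpairsP[[p q] /=].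
rewrite msuppX inE => -[_ /eqP-> mE].
by rewrite mE mnmDE mnm1E eqxx addn1 in mi.
Qed.

Lemma div_var_mulX_gt v i f : (v < i)%N ->
  div_var v ('X_i * f) = 'X_i * div_var v f.
Proof.
move=> vi; apply/mpolyP => m.
rewrite mcoeff_div_var !mcoeff_mulX mcoeff_div_var mnmDE mnm1E.
rewrite (_ : (v == i) = false) ?addn0; last by rewrite -val_eqE ltn_eqF.
have [mi|] := boolP (0 < m i)%N; last by rewrite if_same.
have <- : avoids_below v (m - U_(i))%MM = avoids_below v m.
  by rewrite -[in RHS](mnm_subK mi) avoids_belowD // ltnW.
suff -> : (m + U_(v) - U_(i) = m - U_(i) + U_(v))%MM by [].
apply/mnmP => j; rewrite !(mnmDE, mnmBE, mnm1E).
by case: (i =P j) => [<-|_]; [rewrite addnBAC | rewrite !subn0].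
Qed.

Lemma div_var_mulX_lt v i f : (i < v)%N -> div_var v ('X_i * f) = 0.
Proof.
move=> iv; apply/mpolyP => m; rewrite mcoeff_div_var mcoeff_mulX mcoeff0.
case: ifP => // /avoids_belowP/(_ _ iv) mi0.
by rewrite mnmDE mi0 mnm1E -val_eqE (gtn_eqF iv).
Qed.

Definition is_min A v : bool := (v \in A) && [forall j in A, (v <= j)%N].

Lemma is_minP A v :
  reflect (v \in A /\ forall j, j \in A -> (v <= j)%N) (is_min A v).
Proof.
by apply: (iffP andP) => -[vA /forall_inP].
Qed.

Lemma is_min_inj A v i : is_min A v -> is_min A i -> v = i.
Proof.
move=> /is_minP[vA vmin] /is_minP[iA imin].
by apply/val_inj/eqP; rewrite eqn_leq vmin ?imin.
Qed.

Lemma exists_min A : A != set0 -> exists v, is_min A v.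
Proof.
move=> /set0Pn[x xA].
case: (arg_minnP (fun i : 'I_n => i : nat) xA) => v vA vmin.
by exists v; apply/is_minP.
Qed.

(** The coefficient of e_A comes from e_(A \ v) with v = min A.  The sum has at
    most one term, and none for A empty.  No sign occurs, since v precedes all
    the elements of A \ v. *)
Definition contraction (a : koszulS) : koszulS :=
  [ffun A => \sum_(v | is_min A v) div_var v (a (A :\ v))].

Lemma contraction_min a A v : is_min A v ->
  contraction a A = div_var v (a (A :\ v)).
Proof.
move=> vA; rewrite ffunE (big_pred1 v) // => i.
by apply/idP/eqP => [iA|->//]; apply: is_min_inj iA vA.
Qed.

Lemma contraction_set0 a : contraction a set0 = 0.
Proof. by rewrite ffunE big_pred0 // => v; rewrite /is_min inE. Qed.

Lemma div_var_sum v (J : Type) (s : seq J) (P : pred J) (f : J -> S) :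
  div_var v (\sum_(j <- s | P j) f j) = \sum_(j <- s | P j) div_var v (f j).
Proof. exact: (big_morph _ (div_varD v) (div_var0 v)). Qed.

Lemma is_minU1_gt A v i : is_min A v -> (v < i)%N -> is_min (i |: A) v.
Proof.
move=> /is_minP[vA vmin] vi; apply/is_minP; split; first by rewrite inE vA orbT.
by move=> j; rewrite inE => /orP[/set1P->|/vmin//]; apply: ltnW.
Qed.

Lemma is_minU1_lt A i : (forall j, j \in A -> (i < j)%N) -> is_min (i |: A) i.
Proof.
move=> iA; apply/is_minP; split; first by rewrite inE set11.
by move=> j; rewrite inE => /orP[/set1P->|/iA /ltnW].
Qed.

(** The part of f consisting of the monomials with least variable x_i. *)
Definition lead_part i f : S := 'X_i * div_var i f.

Lemma mcoeff_lead_part i f m :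
  (lead_part i f)@_m = if (0 < m i)%N && avoids_below i m then f@_m else 0.
Proof.
rewrite mcoeff_mulX; case: ifP => //= mi; rewrite mcoeff_div_var mnm_subK //.
by rewrite -(avoids_belowD (m - U_(i))%MM (leqnn i)) mnm_subK.
Qed.

(** Every monomial has at most one least variable, so for an initial segment P
    of the variables the leading parts add up to the part of f consisting of the
    monomials that involve a variable in P. *)
Lemma sum_lead_part (P : pred 'I_n) f m :
  (forall i j : 'I_n, P i -> (j < i)%N -> P j) ->
  (\sum_(i | P i) lead_part i f)@_m =
    if [exists i, P i && (0 < m i)%N] then f@_m else 0.
Proof.
move=> Pdown; rewrite raddf_sum /=; case: ifP => [/existsP[i0 Pi0]|mP].
  have [i /andP[Pi mi] imin] := @arg_minnP _ i0
    (fun i => P i && (0 < m i)%N) (fun i : 'I_n => i : nat) Pi0.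
  have mlt : avoids_below i m.
    apply/avoids_belowP => j ji; apply/eqP.
    rewrite -leqn0 leqNgt; apply/negP => mj.
    by have := imin j; rewrite (Pdown i j) // mj leqNgt ji => /(_ isT).
  rewrite (bigD1 i) //= big1 ?addr0 ?mcoeff_lead_part ?mi ?mlt //.
  move=> j /andP[Pj ji]; rewrite mcoeff_lead_part.
  case: ifP => // /andP[mj /avoids_belowP jlt].
  case/negP: ji; apply/eqP/val_inj/eqP.
  rewrite eqn_leq imin ?Pj ?mj // andbT leqNgt.
  by apply/negP => /jlt mi0; rewrite mi0 in mi.
rewrite big1 // => i Pi; rewrite mcoeff_lead_part.
case: ifP => // /andP[mi _].
by case/negP: (negbT mP); apply/existsP; exists i; rewrite Pi.
Qed.

(** At e_A with v = min A, the terms of d (h a) that add an index i > v to A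
    cancel against those of h (d a), where the removed v accounts for the
    opposite sign.  The terms of d (h a) that add i < v give the part of a A
    with least variable x_i.  The term of h (d a) that puts v back gives the
    part of a A free of the variables below x_v.  Together these make up a A. *)
Lemma contractionP a : a set0 = 0 -> d (contraction a) + contraction (d a) = a.
Proof.
move=> a0; apply/ffunP => A; rewrite [LHS]ffunE.
have [->|A0] := eqVneq A set0.
  rewrite contraction_set0 addr0 ffunE a0.
  rewrite big1 // => i _; rewrite (contraction_min _ (v := i)).
    rewrite setU0 setDv a0 div_var0 mulr0 //.
  by apply: is_minU1_lt => j; rewrite inE.
have [v vA] := exists_min A0; have [vinA vmin] := is_minP _ _ vA.
rewrite (contraction_min _ vA) !ffunE div_var_sum.
rewrite [X in _ + X](bigD1 v) /=; last by rewrite setD11.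
rewrite (bigID (fun i : 'I_n => (i < v)%N)) /=.
rewrite setD1K // (_ : [set j in A :\ v | (j < v)%N] = set0); last first.
  apply/setP => j; rewrite !inE; apply/negP => /andP[/andP[_ /vmin]].
  by rewrite leqNgt => /negPf->.
rewrite cards0 expr0 mul1r.
set gts := \sum_(i | _ && ~~ _) _.
set rest := \sum_(i | (i \notin A :\ v) && _) _.
(* The terms of h (d a) that add some i < v to A \ v vanish. *)
have -> : rest = - gts.
  rewrite /rest /gts -sumrN.
  rewrite (eq_bigl (fun i => i \notin A)); last first.
    move=> i; rewrite in_setD1; have [->|] := eqVneq i v; last by rewrite andbT.
    by rewrite vinA.
  rewrite (bigID (fun i : 'I_n => (i < v)%N)) /=.
  rewrite big1 ?add0r => [|i /andP[iA iv]].
    apply: eq_bigr => i /andP[iA]; rewrite -leqNgt => vi.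
    have {}vi : (v < i)%N.
      by rewrite ltn_neqAle vi andbT; apply: contra iA => /eqP /val_inj <-.
    rewrite -mulrA div_var_sign div_var_mulX_gt //.
    rewrite (contraction_min _ (is_minU1_gt vA vi)).
    rewrite -mulNr -mulNr -mulrA; congr (_ * (_ * div_var v (a _))).
      rewrite [in RHS](cardsD1 v) inE vinA vi exprS mulN1r opprK.
      congr (_ ^+ #|pred_of_set _|).
      by apply/setP => j; rewrite !inE andbA.
    apply/setP => j; rewrite !inE; have [->|//] := eqVneq j v.
    by rewrite -val_eqE ltn_eqF.
  by rewrite -mulrA div_var_sign div_var_mulX_lt // mulr0.
rewrite addrACA subrr addr0.
apply/mpolyP => m; rewrite mcoeffD.
rewrite (eq_bigl (fun i : 'I_n => (i < v)%N)); last first.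
  by move=> i; apply/andb_idl => iv; apply/negP => /vmin; rewrite leqNgt iv.
rewrite (eq_bigr (fun i => lead_part i (a A))) => [|i iv]; last first.
  have iA j : j \in A -> (i < j)%N by move=> /vmin; apply: leq_trans.
  rewrite (contraction_min _ (is_minU1_lt iA)) setU1K; last first.
    by apply/negP => /iA; rewrite ltnn.
  rewrite (_ : [set j in A | (j < i)%N] = set0) ?cards0 ?expr0 ?mul1r //.
  apply/setP => j; rewrite !inE; apply/negP => /andP[/iA ij].
  by rewrite ltnNge ltnW.
rewrite sum_lead_part; last by move=> i j iv /ltn_trans; apply.
rewrite mcoeff_div_var mcoeff_mulX mnmDE mnm1E eqxx addn1 /= addmK.
rewrite (_ : avoids_below v m = ~~ [exists i : 'I_n, (i < v)%N && (0 < m i)%N]).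
  by case: ifP; rewrite ?addr0 ?add0r.
rewrite negb_exists; apply: eq_forallb => i; rewrite negb_and -implybE.
by rewrite lt0n negbK.
Qed.

End Contraction.

(** * The Koszul differential *)

Section KoszulSquare.
Variables (R : comPzRingType) (n : nat) (x : 'I_n -> R).
Implicit Types (a : {ffun {set 'I_n} -> R}) (A : {set 'I_n}).

Lemma card_below_U1 A (i j : 'I_n) : i \notin A ->
  #|[set l in i |: A | (l < j)%N]| = ((i < j) + #|[set l in A | (l < j)%N]|)%N.
Proof.
move=> iA; rewrite (cardsD1 i) !inE eqxx /=; congr (_ + #|pred_of_set _|)%N.
apply/setP => l; rewrite !inE; have [->|//] := eqVneq l i.
by rewrite (negbTE iA).
Qed.

(** The two orders in which a pair of indices i, j is added to A contribute
    opposite signs.  The sum is split according to the order of i and j, instead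
    of being compared with its own opposite, because 2 may be zero in R. *)
Lemma koszul_d_square a : koszul_d x (koszul_d x a) = 0.
Proof.
apply/ffunP => A; rewrite ffunE [RHS]ffunE.
pose s (i : 'I_n) := (-1) ^+ #|[set l in A | (l < i)%N]| : R.
pose t i j := s i * s j * (x i * x j) * a (j |: (i |: A)).
have tC i j : t i j = t j i.
  by rewrite /t setUCA [s i * _]mulrC [x i * _]mulrC.
transitivity (\sum_(i | i \notin A) \sum_(j | (j \notin A) && (j != i))
    (-1) ^+ (i < j)%N * t i j).
  apply: eq_bigr => i iA; rewrite ffunE mulr_sumr; apply: eq_big => [j|j _].
    by rewrite in_setU1 negb_or andbC.
  rewrite card_below_U1 // exprD /t /s; ring.
under eq_bigr => i iA.
  rewrite (bigID (fun j : 'I_n => (i < j)%N)) /=.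
  over.
rewrite big_split /= [X in _ + X](exchange_big_dep (fun j => j \notin A)) /=;
  last first.
  by move=> i j _ /andP[/andP[]].
rewrite -big_split big1 //= => i iA.
rewrite [X in _ + X](eq_bigl
  (fun j => (j \notin A) && (j != i) && (i < j)%N)); last first.
  move=> j; rewrite iA /= [i == j]eq_sym -leqNgt -!andbA; congr (_ && _).
  by have [//|ji] := eqVneq j i; rewrite leq_eqVlt val_eqE eq_sym (negbTE ji).
rewrite -big_split big1 //= => j /andP[_ ij].
by rewrite ij ltnNge (ltnW ij) /= expr1 expr0 mulN1r mul1r tC addNr.
Qed.

Lemma koszul_d_homogeneous i a :
  koszul_homogeneous i.+1 a -> koszul_homogeneous i (koszul_d x a).
Proof.
move=> ai A; apply: contraNeq => Ai; rewrite ffunE big1 // => j jA.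
have [->|/ai] := eqVneq (a (j |: A)) 0; first by rewrite mulr0.
by rewrite cardsU1 jA => -[/eqP]; rewrite (negbTE Ai).
Qed.

End KoszulSquare.

(** * Golodness from cycles with small coefficients *)

Section Criterion.
Variables (K : fieldType) (n : nat) (L : ideal {mpoly K[n]}).
Local Notation S := {mpoly K[n]}.
Local Notation koszulS := {ffun {set 'I_n} -> S}.
Local Notation d := (koszul_d (fun i : 'I_n => 'X_i : S)).
Implicit Types (a b c : koszul L) (h g : homology L) (z : koszulS).

Lemma quot_pi_eq0 f : quot_pi L f = 0 <-> L f.
Proof.
have pi0 : quot_pi L 0 = 0.
  by apply: (addrI (quot_pi L 0)); rewrite -quot_piD !addr0.
rewrite -pi0; split=> [/quot_piP|Lf]; first by rewrite subr0 => /asboolP.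
by apply/quot_piP; rewrite subr0; apply/asboolP.
Qed.

Lemma quot_piB : {morph quot_pi L : f g / f - g}.
Proof.
move=> f g; apply/eqP; rewrite eq_sym subr_eq; apply/eqP.
by rewrite -[RHS]quot_piD subrK.
Qed.

Lemma quot_pi_sign s f : quot_pi L ((-1) ^+ s * f) = (-1) ^+ s * quot_pi L f.
Proof.
rewrite -signr_odd -[in RHS]signr_odd !mulr_sign; case: ifP => // _.
by rewrite -[- f]sub0r quot_piB (quot_pi_eq0 0).2 ?sub0r //; apply: ideal0.
Qed.

Definition koszul_pi z : koszul L := [ffun A => quot_pi L (z A)].

Lemma koszul_piD : {morph koszul_pi : y z / y + z}.
Proof. by move=> y z; apply/ffunP => A; rewrite !ffunE -[RHS]quot_piD. Qed.

Lemma koszul_pi_d z : koszul_diff (koszul_pi z) = koszul_pi (d z).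
Proof.
apply/ffunP => A; rewrite !ffunE.
have pi0 : quot_pi L 0 = 0 by apply/quot_pi_eq0/ideal0.
rewrite (big_morph (quot_pi L) (@quot_piD _ _ _) pi0).
by apply: eq_bigr => i _; rewrite ffunE -!mulrA quot_pi_sign -quot_piM.
Qed.

Lemma koszul_diffB a b : koszul_diff (a - b) = koszul_diff a - koszul_diff b.
Proof. by rewrite -scaleN1r koszul_diffD koszul_diffZ scaleN1r. Qed.

Lemma represents_cycle a : koszul_diff a = 0 -> exists h, represents a h.
Proof.
move=> /eqP a0; exists (\pi_(quot_lmod (boundaries L)) (KoszulCycle a0)).
by exists (KoszulCycle a0).
Qed.

Lemma represents_is_cycle a h : represents a h -> koszul_diff a = 0.
Proof. by case=> z <- _; apply/eqP/(valP z). Qed.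

Lemma represents_inj a h g : represents a h -> represents a g -> h = g.
Proof.
move=> [y ya ->] [z za ->]; congr (\pi _).
by apply/val_inj; rewrite /= ya.
Qed.

Lemma representsD a b h g : represents a h -> represents b g ->
  represents (a + b) (h + g).
Proof.
move=> [y <- ->] [z <- ->]; by exists (y + z); rewrite ?quot_piD.
Qed.

Lemma represents0 : represents 0 (0 : homology L).
Proof.
have [h h0] := represents_cycle (koszul_diff0 L).
suff <- : h = 0 by [].
have := representsD h0 h0; rewrite addr0 => /(represents_inj h0) hh.
by apply: (addrI h); rewrite addr0 -hh.
Qed.

Lemma represents_homologous a b c h :
  koszul_diff c = a - b -> represents a h -> represents b h.
Proof.
move=> cE ah; have a0 := represents_is_cycle ah.
have /eqP b0 : koszul_diff b = 0.
  have -> : b = a - koszul_diff c by rewrite cE opprB addrC subrK.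
  rewrite koszul_diffB a0 sub0r; apply/eqP; rewrite oppr_eq0.
  exact/eqP/koszul_d_square.
case: ah => y ya ->; exists (KoszulCycle b0) => //.
apply/eqP; rewrite quot_eq; apply/asboolP; exists c.
by rewrite cE -ya.
Qed.

Definition homogeneous_part i a : koszul L :=
  [ffun A : {set 'I_n} => if #|A| == i then a A else 0].

Lemma homogeneous_partP i a : koszul_homogeneous i (homogeneous_part i a).
Proof. by move=> A; rewrite ffunE; case: ifP => [/eqP//|]; rewrite eqxx. Qed.

Lemma homogeneous_part_cycle i a :
  koszul_diff a = 0 -> koszul_diff (homogeneous_part i a) = 0.
Proof.
move=> a0; apply/ffunP => A; move/ffunP/(_ A): a0; rewrite !ffunE => a0.
have [Ai|Ai] := eqVneq #|A|.+1 i.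
  rewrite -[RHS]a0; apply: eq_bigr => j jA.
  by rewrite ffunE cardsU1 jA add1n Ai eqxx.
by rewrite big1 // => j jA; rewrite ffunE cardsU1 jA add1n (negbTE Ai) mulr0.
Qed.

Lemma sum_homogeneous_part a : \sum_(0 <= i < n.+1) homogeneous_part i a = a.
Proof.
rewrite big_mkord; apply/ffunP => A; rewrite sum_ffunE.
have An : (#|A| < n.+1)%N by rewrite ltnS -[leqRHS]card_ord max_card.
rewrite (bigD1 (Ordinal An)) //= ffunE eqxx big1 ?addr0 // => i iA.
by rewrite ffunE; case: (#|A| =P i) => // Ai; case/eqP: iA; apply: val_inj.
Qed.

Lemma represents_sum (J : Type) (s : seq J) (a : J -> koszul L)
    (h : J -> homology L) :
  (forall j, represents (a j) (h j)) ->
  represents (\sum_(j <- s) a j) (\sum_(j <- s) h j).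
Proof.
move=> ah; elim: s => [|j s IHs]; first by rewrite !big_nil; apply: represents0.
by rewrite !big_cons; apply: representsD.
Qed.

(** A reduction of the Golod property to one kind of cycles: choose a basis
    among the classes of homogeneous cycles of positive degree, represent it by
    cycles with coefficients in J, and let mu vanish on longer sequences.  For
    sequences of length two the Massey relation says that products of these
    cycles are zero, and this holds since J * J is contained in L; for longer
    sequences every product in the relation has a zero factor. *)
Lemma golod_of_small_cycles (J : S -> Prop) :
    (forall f1 f2, J f1 -> J f2 -> L (f1 * f2)) ->
    (forall i a, (0 < i)%N -> koszul_homogeneous i a -> koszul_diff a = 0 ->
       exists b c, [/\ koszul_homogeneous i b,
         forall A, exists2 f, J f & b A = quot_pi L f &
         koszul_diff c = a - b]) ->
  golod L.
Proof.
move=> JJ small.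
pose gens h := exists2 i, (1 <= i)%N & homology_deg i h.
have [B [Bgens Bind Bspan]] := exists_basis_of_generators gens.
pose good h b := [/\ exists i, koszul_homogeneous i b,
  forall A, exists2 f, J f & b A = quot_pi L f & represents b h].
have /choice[rep repP] : forall h, exists b, B h -> good h b.
  move=> h.
  have [Bh|nBh] := pselect (B h); last by exists 0.
  have [i i0 [a ai ah]] := Bgens h Bh.
  have [b [c [bi bJ cE]]] := small i a i0 ai (represents_is_cycle ah).
  exists b => _; split=> //; first by exists i.
  exact: represents_homologous cE ah.
exists B, (fun s => if s is [:: h] then rep h else 0); split.
  split=> // h [a a0 ah].
  have ad := represents_is_cycle ah.
  have /choice[g gP] i := represents_cycle (homogeneous_part_cycle i ad).
  have -> : h =
      \sum_(p <- [seq (1, g i) | i <- index_iota 0 n.+1]) p.1 *: p.2.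
    rewrite big_map /=; under eq_bigr do rewrite scale1r.
    apply: (represents_inj ah).
    rewrite -[X in represents X](sum_homogeneous_part a).
    exact: represents_sum.
  apply: in_span_sum => _ /mapP[[|i] _ ->] /=; last first.
    apply: Bspan; exists i.+1 => //.
    by exists (homogeneous_part i.+1 a) => //; apply: homogeneous_partP.
  (* B spans the classes of positive degree only; the part of degree 0 is 0. *)
  suff -> : g 0%N = 0 by exists [::], (fun=> 0); rewrite big_nil; split.
  apply: represents_inj (gP 0%N) _.
  suff -> : homogeneous_part 0 a = 0 by apply: represents0.
  apply/ffunP => A; rewrite !ffunE cards_eq0.
  by case: eqP => // ->.
split=> [s s0 sB|h /repP[]//|s s2 sB].
  case: s s0 sB => // h [|h' s] _ sB; last first.
    by exists 0%N => A; rewrite ffunE eqxx.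
  by case: (repP h) => //; apply: sB; rewrite inE.
have -> : (if s is [:: h] then rep h else 0) = 0 by case: s s2 {sB} => [|h []].
rewrite [LHS]koszul_diff0 big_nat big1 // => j /andP[j0 js].
apply/ffunP => C; rewrite !ffunE big1 // => A _; rewrite ffunE.
case: s s2 sB j0 js => [|h [|h' [|h'' s]]] //= _ sB.
  case: j => [|[|j]] //= _ _.
  have [_ /(_ A) [f Jf ->] _] : good h (rep h).
    by apply/repP/sB; rewrite inE eqxx.
  have [_ /(_ (C :\: A)) [g Jg ->] _] : good h' (rep h').
    by apply/repP/sB; rewrite !inE eqxx orbT.
  rewrite mulrA -exprD -mulrA [quot_pi L f * _]quot_piM.
  by rewrite (quot_pi_eq0 _).2 ?mulr0 //; apply: JJ.
by case: j => [|[|[|j]]] //= _ _; rewrite ?ffunE ?mulr0 ?mul0r ?mulr0 ?mul0r.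
Qed.

End Criterion.

(** * Intersections of powers of ideals generated by variables *)

Section MonomialPrimePowers.
Variables (K : fieldType) (n : nat) (D : {set 'I_n} -> Prop).
Local Notation S := {mpoly K[n]}.
Local Notation d := (koszul_d (fun i : 'I_n => 'X_i : S)).

Definition cap_powers k : ideal S :=
  ideal_bigcap D (fun F => ideal_exp (var_ideal K F) k).

Lemma cap_powersP k f :
  cap_powers k f <-> forall F, D F -> order_ge F k f.
Proof.
by split=> fk F DF; apply/var_ideal_expP; apply: fk.
Qed.

Lemma cap_powers_div_var k v f :
  cap_powers k f -> cap_powers k.-1 (div_var v f).
Proof.
move=> /cap_powersP fk; apply/cap_powersP => F DF m.
rewrite mcoeff_div_var; case: ifP; last by rewrite eqxx.
move=> _ /(fk F DF); rewrite degree_inD degree_inU => km.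
by rewrite -subn1 leq_subLR (leq_trans km) // addnC leq_add2r leq_b1.
Qed.

Lemma cap_powers_mul_pred k f g : (1 < k)%N ->
  cap_powers k.-1 f -> cap_powers k.-1 g -> cap_powers k (f * g).
Proof.
move=> k1 /cap_powersP fk /cap_powersP gk; apply/cap_powersP => F DF.
apply: order_geS (order_geM (fk F DF) (gk F DF)).
by case: k k1 {fk gk} => [|[|k]] //= _; rewrite addnS addSn !ltnS leq_addr.
Qed.

Lemma cap_powers_contraction k (z : {ffun {set 'I_n} -> S}) :
  (forall A, cap_powers k (z A)) ->
  forall A, cap_powers k.-1 (contraction z A).
Proof.
move=> zk A; have [->|/exists_min[v vA]] := eqVneq A set0.
  by rewrite contraction_set0; apply: ideal0.
by rewrite (contraction_min _ vA); apply: cap_powers_div_var.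
Qed.

Lemma contraction_homogeneous i (z : {ffun {set 'I_n} -> S}) :
  koszul_homogeneous i z -> koszul_homogeneous i.+1 (contraction z).
Proof.
move=> zi A; have [->|/exists_min[v vA]] := eqVneq A set0.
  by rewrite contraction_set0 eqxx.
rewrite (contraction_min _ vA).
have [->|/zi iA _] := eqVneq (z (A :\ v)) 0; first by rewrite div_var0 eqxx.
by rewrite (cardsD1 v) (is_minP _ _ vA).1 iA.
Qed.

(** A homogeneous cycle lifts to z over S, and h (d z) = z - d (h z) is the
    homologous cycle with coefficients in L_(k-1). *)
Theorem golod_cap_powers k : (1 < k)%N -> golod (cap_powers k).
Proof.
move=> k1; set L := cap_powers k.
apply: (@golod_of_small_cycles _ _ _ (cap_powers k.-1)).
  by move=> f g; apply: cap_powers_mul_pred.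
case=> // i a _ ai a0.
have [z za zi] : exists2 z : {ffun {set 'I_n} -> S},
    koszul_pi L z = a & koszul_homogeneous i.+1 z.
  (* The representative of 0 in S need not be 0, and z has to be homogeneous. *)
  exists [ffun A => if a A == 0 then 0 else quot_repr (a A)].
    apply/ffunP => A; rewrite !ffunE.
    case: eqP => [->|_]; last exact: quot_reprK.
    by apply/quot_pi_eq0/ideal0.
  by move=> A; rewrite ffunE; case: ifP => [|/negbT /ai //]; rewrite eqxx.
have z0 : z set0 = 0.
  by apply/eqP; apply: contraT => /zi; rewrite cards0.
exists (koszul_pi L (contraction (d z))), (koszul_pi L (contraction z)); split.
- move=> A; rewrite ffunE => zA.
  apply: (contraction_homogeneous
    (koszul_d_homogeneous (x := fun i => 'X_i) zi)).
  by apply: contraNneq zA => ->; apply/eqP/quot_pi_eq0/ideal0.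
- move=> A; exists (contraction (d z) A); last by rewrite ffunE.
  apply: cap_powers_contraction => C; apply/quot_pi_eq0.
  by move: a0; rewrite -za koszul_pi_d => /ffunP/(_ C); rewrite !ffunE.
rewrite koszul_pi_d -za -(congr1 (koszul_pi L) (contractionP z0)) koszul_piD.
by rewrite addrK.
Qed.

End MonomialPrimePowers.

Theorem theorem1p2 (K : fieldType) (n : nat) (I : ideal {mpoly K[n]})
    (Isqf : squarefree_monomial_ideal I) (I_neq_S : ~ (forall f, I f)) :
  exists k0 : nat, forall k : nat, (k0 <= k)%N -> golod (symbolic_power I k).
Proof. by exists 2 => k k2; apply: golod_cap_powers. Qed.
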